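(* Let $\mu,\nu\in\mathbb{R}$ be such that neither $\mu+\nu$ nor $\mu-\nu$ is a negative odd integer and $(\mu+1)\bigl((\mu+1)(\mu+3)-\nu^2\bigr)\geq \frac18$. If $$\mu(2e-1)-\frac14e(e-1)\left|(\mu-1)^2-\nu^2\right|\geq e^3-e^2+\frac{13e}{4}-4,$$ then $\mathfrak{f}_{\mu,\nu}\in\mathscr{K}_e$ and hence $\mathfrak{h}_{\mu,\nu}\in\mathscr{S}^*_e$.
   Context: $\mathbb{D}=\{z\in\mathbb{C}:|z|<1\}$. For analytic functions $f,g$ on $\mathbb{D}$, $f\prec g$ ($f$ is subordinate to $g$) means there is an analytic $w:\mathbb{D}\to\mathbb{C}$ with $w(0)=0$, $|w(z)|<1$ for all $z\in\mathbb{D}$ and $f=g\circ w$. $\mathscr{P}_e$ is the family of analytic functions $p$ in $\mathbb{D}$ with $p(0)=1$ and $p(z)\prec e^z$. $\mathscr{A}$ is the class of analytic functions $f$ on $\mathbb{D}$ with $f(0)=0$, $f'(0)=1$. $\mathscr{K}_e$ (exponential convex functions) is the class of $f\in\mathscr{A}$ such that $1+zf''(z)/f'(z)$ belongs to $\mathscr{P}_e$; $\mathscr{S}^*_e$ (exponential starlike functions) is the class of $f\in\mathscr{A}$ such that $zf'(z)/f(z)$ (with value $1$ at $z=0$) belongs to $\mathscr{P}_e$. For $\mu\pm\nu$ not negative odd integers, the Lommel function of the first kind is $\mathfrak{s}_{\mu,\nu}(z)=\frac{z^{\mu+1}}{(\mu-\nu+1)(\mu+\nu+1)}\,{}_1F_2\!\left(1;\frac{\mu-\nu+3}{2},\frac{\mu+\nu+3}{2};-\frac{z^2}{4}\right)$,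 and its normalization is $\mathfrak{h}_{\mu,\nu}(z)=(\mu-\nu+1)(\mu+\nu+1)z^{(1-\mu)/2}\mathfrak{s}_{\mu,\nu}(\sqrt z)$, i.e. $$\mathfrak{h}_{\mu,\nu}(z)=z+\sum_{n\ge1}\frac{(-1/4)^n}{((\mu-\nu+3)/2)_n((\mu+\nu+3)/2)_n}z^{n+1}\qquad(z\in\mathbb{D}),$$ where $(x)_n=x(x+1)\cdots(x+n-1)$. Its Alexander transform is $\mathfrak{f}_{\mu,\nu}(z)=\int_0^z\frac{\mathfrak{h}_{\mu,\nu}(t)}{t}\,dt$ for $z\in\mathbb{D}$. Both functions lie in $\mathscr{A}$. *)

(* Defs.v *)
From Stdlib Require Import Reals.
From Coquelicot Require Import Coquelicot.
Open Scope R_scope.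

Definition in_disk (z : C) : Prop := Cmod z < 1.

(* Functions on the disk are represented by total functions [C -> C] whose
   values outside the (open) disk are irrelevant; "analytic" is complex
   differentiability at every point of the disk. *)
Definition analytic_disk (f : C -> C) : Prop :=
  forall z : C, in_disk z -> ex_derive (K := C_AbsRing) (V := C_NormedModule) f z.

Definition Cexp (z : C) : C := (exp (Re z) * cos (Im z), exp (Re z) * sin (Im z)).

(* Total sum of a complex series; meaningful for convergent series only. *)
Definition CSeries (a : nat -> C) : C :=
  iota (T := C_CompleteNormedModule)
       (fun l : C => is_series (K := C_AbsRing) (V := C_NormedModule) a l).

Lemma CSeries_unique (a : nat -> C) (l : C) :
  is_series (K := C_AbsRing) (V := C_NormedModule) a l -> CSeries a = l.
Proof.
intros H.
exact (iota_filterlim_locally (K := C_AbsRing) (V := C_CompleteNormedModule) _ l H).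
Qed.

Definition subordinate (f g : C -> C) : Prop :=
  exists w : C -> C,
    analytic_disk w /\ w 0 = 0 /\
    (forall z : C, in_disk z -> Cmod (w z) < 1) /\
    (forall z : C, in_disk z -> f z = g (w z)).

Definition class_Pe (p : C -> C) : Prop :=
  analytic_disk p /\ p 0 = 1 /\ subordinate p Cexp.

Definition class_A (f : C -> C) : Prop :=
  analytic_disk f /\ f 0 = 0 /\ C_derive f 0 = 1.

(* As division is total, the conditions that the denominators of
   [1 + z f''/f'] and [z f'/f] do not vanish are stated explicitly in the next
   two definitions. *)
Definition exp_convex (f : C -> C) : Prop :=
  class_A f /\
  (forall z : C, in_disk z -> C_derive f z <> 0) /\
  class_Pe (fun z : C => 1 + z * C_derive (C_derive f) z / C_derive f z)%C.

Definition exp_starlike (f : C -> C) : Prop :=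
  class_A f /\
  (forall z : C, in_disk z -> z <> 0 -> f z <> 0) /\
  class_Pe (fun z : C => if Ceq_dec z 0 then RtoC 1 else z * C_derive f z / f z)%C.

Fixpoint pochhammer (x : R) (n : nat) : R :=
  match n with
  | O => 1
  | S m => pochhammer x m * (x + INR m)
  end.

Definition negative_odd_integer (x : R) : Prop :=
  exists k : nat, x = - (2 * INR k + 1).

Definition lommel_coef (mu nu : R) (n : nat) : R :=
  (- (1 / 4)) ^ n /
  (pochhammer ((mu - nu + 3) / 2) n * pochhammer ((mu + nu + 3) / 2) n).

(* [(mu - nu + 1) (mu + nu + 1) z^((1 - mu) / 2) s(sqrt z)] for the Lommel function
   of the first kind [s], through its single-valued expansion on the disk:
   (1)_n cancels the n! of the 1F2 series. *)
Definition lommel_h (mu nu : R) (z : C) : C :=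
  (z + CSeries (fun n : nat => RtoC (lommel_coef mu nu (S n)) * z ^ (S n + 1)))%C.

(* The integral of [h t / t] along the segment [t = s z], [0 <= s <= 1].  The value of
   the integrand at the endpoint [s = 0] does not affect the Riemann integral. *)
Definition alexander (h : C -> C) (z : C) : C :=
  RInt (V := C_R_CompleteNormedModule)
       (fun s : R => (h (RtoC s * z) / (RtoC s * z) * z)%C) 0 1.

Definition lommel_f (mu nu : R) : C -> C := alexander (lommel_h mu nu).

(* Main.v *)
Require Import Defs.
From Stdlib Require Import Reals Lra Lia.
From Coquelicot Require Import Coquelicot.
Open Scope R_scope.

(** Write [c n] for the Lommel coefficients and [G] for the sum of [c n * z ^ n].
    Then [h = z G] and [f' = h / z = G], so that both classes speak of one and the
    same function
      [p = 1 + z f'' / f' = z h' / h = 1 + z G' / G].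

    The hypothesis on [mu] and [nu] is so strong that [p] stays close to 1, and a
    function close to 1 is automatically subordinate to the exponential. Indeed it
    forces [(mu + 3)^2 - nu^2 >= 12] and [mu >= 2] ([main_condition_bounds]). The two
    Pochhammer parameters are then positive with product at least 3, whence
    [|c n| <= (1 / 12) ^ n] ([lommel_coef_bound]). Summing geometric series gives
    [|G - 1| <= 1 / 11] and [|G'| <= 1 / 10] on the disk, so [G] has no zero and
    [|p - 1| <= 11 / 100] ([log_ratio_class_Pe]). The principal logarithm of [p] is
    therefore analytic, vanishes at 0 and has modulus less than 1
    ([Cmod_Clog_lt_1]): it is the function [w] with [p = exp o w] that the
    subordination asks for ([class_Pe_near_1]).

    The rest is complex calculus: termwise differentiation of power series
    ([CPSeries_is_derive]), the derivative of the logarithm ([Cis_derive_Clog]),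
    and the identification of the Alexander transform, an integral along a
    segment, with the primitive of [G] ([alexander_primitive]). *)

(** * Complex derivatives *)

Lemma norm_R2_Cmod (p : R * R) :
  @norm R_AbsRing (prod_NormedModule R_AbsRing R_NormedModule R_NormedModule) p
  = Cmod p.
Proof.
change (sqrt (Rabs (fst p) ^ 2 + Rabs (snd p) ^ 2) = Cmod p).
unfold Cmod. now rewrite !pow2_abs.
Qed.

Notation Cis_derive f z l :=
  (is_derive (K := C_AbsRing) (V := C_NormedModule) f z l).
Notation Cis_series a l :=
  (is_series (K := C_AbsRing) (V := C_NormedModule) a l).

Lemma Cis_derive_eps (f : C -> C) (z l : C) :
  Cis_derive f z l <->
  (forall eps : posreal, exists d : posreal, forall w : C,
     Cmod (w - z) < d ->
     Cmod (f w - f z - (w - z) * l) <= eps * Cmod (w - z)).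
Proof.
split.
- intros [_ H] eps.
  destruct (H z (fun P HP => HP) eps) as [d Hd].
  exists d. intros w Hw. exact (Hd w Hw).
- intros H. split.
  + apply is_linear_scal_l.
  + intros x Hx.
    rewrite <- (is_filter_lim_locally_unique (V := AbsRing_NormedModule C_AbsRing) z x Hx).
    intros eps. destruct (H eps) as [d Hd].
    exists d. intros w Hw. exact (Hd w Hw).
Qed.

(** A quadratic remainder is how derivatives are obtained below, both for the
    reciprocal and for power series: no choice of [d] in terms of [eps] is left. *)
Lemma Cis_derive_quadratic (f : C -> C) (z l : C) (K : R) (d : posreal) :
  (forall w : C, Cmod (w - z) < d ->
     Cmod (f w - f z - (w - z) * l) <= K * Cmod (w - z) ^ 2) ->
  Cis_derive f z l.
Proof.
intros H. apply Cis_derive_eps. intros eps.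
assert (HK : 0 < 1 + Rabs K) by (pose proof (Rabs_pos K); lra).
assert (He : 0 < Rmin d (eps / (1 + Rabs K))).
{ apply Rmin_glb_lt. apply cond_pos.
  apply Rdiv_lt_0_compat; [apply cond_pos | exact HK]. }
exists (mkposreal _ He). simpl. intros w Hw.
eapply Rle_trans; [apply H; eapply Rlt_le_trans; [exact Hw | apply Rmin_l]|].
assert (Hw2 : Cmod (w - z) < eps / (1 + Rabs K))
  by (eapply Rlt_le_trans; [exact Hw | apply Rmin_r]).
pose proof (Cmod_ge_0 (w - z)) as H0.
simpl. rewrite Rmult_1_r, <- Rmult_assoc.
apply Rmult_le_compat_r; [exact H0|].
apply Rle_trans with ((1 + Rabs K) * Cmod (w - z)).
- apply Rmult_le_compat_r; [exact H0|]. pose proof (Rle_abs K); lra.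
- apply Rlt_le. replace (pos eps) with ((1 + Rabs K) * (eps / (1 + Rabs K)))
    by (field; lra).
  apply Rmult_lt_compat_l; assumption.
Qed.

Lemma Cis_derive_inv (z : C) :
  z <> 0 -> Cis_derive Cinv z (- / (z * z))%C.
Proof.
intros Hz.
pose proof (proj1 (Cmod_gt_0 z) Hz) as Hz0.
assert (Hd : 0 < Cmod z / 2) by lra.
apply Cis_derive_quadratic with (K := 2 / Cmod z ^ 3) (d := mkposreal _ Hd).
intros w Hw. simpl in Hw.
assert (Hw0 : Cmod z / 2 <= Cmod w).
{ pose proof (Cmod_triangle w (z - w)) as H1.
  replace (w + (z - w))%C with z in H1 by ring.
  rewrite <- Cmod_opp in H1.
  replace (Cmod (z - w)) with (Cmod (w - z)) in H1
    by (rewrite <- Cmod_opp; f_equal; ring).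
  rewrite Cmod_opp in H1. lra. }
assert (Hwn : w <> 0) by (intros E; rewrite E, Cmod_0 in Hw0; lra).
replace (/ w - / z - (w - z) * - / (z * z))%C
  with ((w - z) * (w - z) * / (w * (z * z)))%C by (field; auto).
assert (Hn : (w * (z * z))%C <> 0) by (repeat apply Cmult_neq_0; assumption).
rewrite !Cmod_mult, Cmod_inv, !Cmod_mult by exact Hn.
replace (2 / Cmod z ^ 3 * Cmod (w - z) ^ 2)
  with (Cmod (w - z) * Cmod (w - z) * / (Cmod z / 2 * (Cmod z * Cmod z)))
  by (field; lra).
apply Rmult_le_compat_l; [apply Rmult_le_pos; apply Cmod_ge_0|].
apply Rinv_le_contravar.
- repeat apply Rmult_lt_0_compat; lra.
- apply Rmult_le_compat_r; [|exact Hw0]. apply Rmult_le_pos; lra.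
Qed.

(** The field of complex numbers is a normed module over itself in two ways, with
    different balls; the product and chain rules speak of one of them, the classes
    of the theorem of the other. *)
Lemma Cis_derive_AbsRing (f : C -> C) (z l : C) :
  Cis_derive f z l <->
  is_derive (K := C_AbsRing) (V := AbsRing_NormedModule C_AbsRing) f z l.
Proof.
split; intros [_ H]; (split; [apply is_linear_scal_l | exact H]).
Qed.

Lemma Cis_derive_mult (f g : C -> C) (z df dg : C) :
  Cis_derive f z df -> Cis_derive g z dg ->
  Cis_derive (fun x => f x * g x)%C z (df * g z + f z * dg)%C.
Proof.
rewrite !Cis_derive_AbsRing. intros Hf Hg.
exact (is_derive_mult (K := C_AbsRing) f g z df dg Hf Hg Cmult_comm).
Qed.

Lemma Cis_derive_comp (f g : C -> C) (z df dg : C) :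
  Cis_derive f (g z) df -> Cis_derive g z dg ->
  Cis_derive (fun x => f (g x)) z (dg * df)%C.
Proof.
rewrite (Cis_derive_AbsRing g). intros Hf Hg.
exact (is_derive_comp (K := C_AbsRing) (V := C_NormedModule) f g z df dg Hf Hg).
Qed.

Lemma Cis_derive_id (z : C) : Cis_derive (fun x => x) z (RtoC 1).
Proof. apply Cis_derive_AbsRing. exact (is_derive_id (K := C_AbsRing) z). Qed.

Lemma Cis_derive_const (k z : C) : Cis_derive (fun _ => k) z (RtoC 0).
Proof. exact (is_derive_const (K := C_AbsRing) (V := C_NormedModule) k z). Qed.

Lemma in_disk_0 : in_disk 0.
Proof. unfold in_disk. rewrite Cmod_0. lra. Qed.

Lemma locally_disk (P : C -> Prop) (z : C) :
  (forall w, in_disk w -> P w) -> in_disk z ->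
  locally (T := AbsRing_UniformSpace C_AbsRing) z P.
Proof.
intros H Hz. unfold in_disk in Hz.
assert (Hd : 0 < 1 - Cmod z) by lra.
assert (Hball : forall w : C, Cmod (w - z) < 1 - Cmod z -> in_disk w).
{ intros w Hw. pose proof (Cmod_triangle z (w - z)) as H1.
  replace (z + (w - z))%C with w in H1 by ring.
  unfold in_disk. lra. }
exists (mkposreal _ Hd). intros w Hw. apply H, Hball. exact Hw.
Qed.

Lemma Cis_derive_ext_disk (f g : C -> C) (z l : C) :
  (forall w, in_disk w -> f w = g w) -> in_disk z ->
  Cis_derive f z l -> Cis_derive g z l.
Proof.
intros H Hz Hf.
refine (is_derive_ext_loc (K := C_AbsRing) (V := C_NormedModule) f g z l _ Hf).
apply locally_disk; assumption.
Qed.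

Lemma C_derive_unique (f : C -> C) (z l : C) :
  Cis_derive f z l -> C_derive f z = l.
Proof. intros H. exact (is_C_derive_unique f z l H). Qed.

(** * Complex power series *)

(** Passing to the limit in the triangle inequality for partial sums. *)
Lemma Cis_series_bound (a : nat -> C) (b : nat -> R) (l : C) (s : R) :
  (forall n, Cmod (a n) <= b n) -> Cis_series a l -> is_series b s ->
  Cmod l <= s.
Proof.
intros Hab Ha Hb.
assert (H1 : is_lim_seq (fun n => norm (sum_n a n)) (Cmod l)).
{ apply (filterlim_comp _ _ _ (sum_n a) norm eventually (locally l) (locally (norm l))).
  exact Ha. apply (filterlim_norm (V := C_NormedModule)). }
assert (H2 : is_lim_seq (sum_n b) s) by exact Hb.
refine (is_lim_seq_le _ _ (Cmod l) s _ H1 H2).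
intros n. unfold sum_n.
eapply Rle_trans; [apply (norm_sum_n_m (V := C_NormedModule))|].
apply sum_n_m_le. exact Hab.
Qed.

Lemma CSeries_correct (a : nat -> C) :
  ex_series (fun n => Cmod (a n)) -> Cis_series a (CSeries a).
Proof.
intros H.
destruct (ex_series_le (V := C_CompleteNormedModule) a (fun n => Cmod (a n)))
  as [l Hl].
- intros n. apply Rle_refl.
- exact H.
- rewrite (CSeries_unique a l Hl). exact Hl.
Qed.

Lemma Cmod_pow_le_1 (z : C) (n : nat) : Cmod z <= 1 -> Cmod (z ^ n) <= 1.
Proof.
intros Hz. rewrite Cmod_pow, <- (pow1 n). apply pow_incr.
split; [apply Cmod_ge_0 | exact Hz].
Qed.

(** On the closed unit disk the second-order remainder of [z ^ n] costs a factor
    [n ^ 2] at most, uniformly in the two points. *)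
Lemma Cpow_taylor (n : nat) (z w : C) :
  Cmod z <= 1 -> Cmod w <= 1 ->
  Cmod (w ^ n - z ^ n - (w - z) * (INR n * z ^ pred n)) <=
  INR n ^ 2 * Cmod (w - z) ^ 2.
Proof.
intros Hz Hw.
induction n as [|n IH].
- replace (w ^ 0 - z ^ 0 - (w - z) * (INR 0 * z ^ pred 0))%C with (RtoC 0).
  + rewrite Cmod_0. simpl. lra.
  + simpl. ring.
- assert (E : (INR n * z ^ pred n * z = INR n * z ^ n)%C).
  { destruct n; simpl pred; [simpl; ring | rewrite Cpow_S; ring]. }
  replace (w ^ S n - z ^ S n - (w - z) * (INR (S n) * z ^ pred (S n)))%C
    with (w * (w ^ n - z ^ n - (w - z) * (INR n * z ^ pred n))
          + INR n * z ^ pred n * ((w - z) * (w - z)))%C.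
  2:{ rewrite S_INR, RtoC_plus, !Cpow_S. simpl pred.
      transitivity (w * w ^ n - z * z ^ n - (w - z) * z ^ n
                    - (w - z) * (INR n * z ^ pred n * z))%C; [ring|].
      rewrite E. ring. }
  eapply Rle_trans; [apply Cmod_triangle|].
  rewrite !Cmod_mult.
  set (X := Cmod (w ^ n - _ - _)) in *.
  pose proof (Cmod_ge_0 (w - z)). pose proof (pos_INR n).
  assert (Hx : 0 <= X) by apply Cmod_ge_0.
  pose proof (Cmod_pow_le_1 z (pred n) Hz) as H1.
  rewrite Cmod_R, Rabs_pos_eq by assumption.
  assert (H2 : Cmod w * X <= INR n ^ 2 * Cmod (w - z) ^ 2).
  { eapply Rle_trans; [|exact IH]. rewrite <- (Rmult_1_l X) at 2.
    apply Rmult_le_compat_r; assumption. }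
  assert (H3 : INR n * Cmod (z ^ pred n) <= INR n).
  { rewrite <- (Rmult_1_r (INR n)) at 2. apply Rmult_le_compat_l; assumption. }
  assert (H4 : INR n * Cmod (z ^ pred n) * (Cmod (w - z) * Cmod (w - z))
               <= INR n * (Cmod (w - z) * Cmod (w - z))).
  { apply Rmult_le_compat_r; [apply Rmult_le_pos|]; assumption. }
  rewrite S_INR.
  assert (0 <= Cmod (w - z) * Cmod (w - z)) by (apply Rmult_le_pos; assumption).
  nra.
Qed.

Definition CPSeries (a : nat -> C) (z : C) : C := CSeries (fun n => a n * z ^ n)%C.
Definition deriv_coef (a : nat -> C) (n : nat) : C := (INR (S n) * a (S n))%C.

(** The weight [n + 1] instead of [n] keeps the constant term, so that the condition
    also implies absolute convergence of the series itself. *)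
Definition summable_sq (a : nat -> C) : Prop :=
  ex_series (fun n => INR (S n) ^ 2 * Cmod (a n)).

Lemma CPSeries_correct (a : nat -> C) (z : C) :
  summable_sq a -> Cmod z <= 1 ->
  Cis_series (fun n => a n * z ^ n)%C (CPSeries a z).
Proof.
intros Ha Hz. apply CSeries_correct.
apply (ex_series_le (V := R_CompleteNormedModule)) with (2 := Ha).
intros n. change (Rabs (Cmod (a n * z ^ n)) <= INR (S n) ^ 2 * Cmod (a n)).
rewrite Rabs_pos_eq, Cmod_mult by apply Cmod_ge_0.
pose proof (Cmod_pow_le_1 z n Hz). pose proof (Cmod_ge_0 (a n)).
pose proof (Cmod_ge_0 (z ^ n)).
assert (1 <= INR (S n)) by (rewrite S_INR; pose proof (pos_INR n); lra).
rewrite Rmult_comm. apply Rmult_le_compat_r; [assumption | nra].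
Qed.

(** The derived series with the index of the original one, to be subtracted from it
    term by term. *)
Lemma CPSeries_derive_shift (a : nat -> C) (z : C) :
  summable_sq a -> Cmod z <= 1 ->
  Cis_series (fun n => a n * (INR n * z ^ pred n))%C (CPSeries (deriv_coef a) z).
Proof.
intros Ha Hz.
set (b := fun n => (a n * (INR n * z ^ pred n))%C).
assert (Hb : Cis_series b (CSeries b)).
{ apply CSeries_correct.
  apply (ex_series_le (V := R_CompleteNormedModule)) with (2 := Ha).
  intros n. change (Rabs (Cmod (b n)) <= INR (S n) ^ 2 * Cmod (a n)).
  unfold b.
  rewrite Rabs_pos_eq, !Cmod_mult, Cmod_R by apply Cmod_ge_0.
  rewrite Rabs_pos_eq by apply pos_INR.
  pose proof (Cmod_pow_le_1 z (pred n) Hz). pose proof (Cmod_ge_0 (a n)).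
  pose proof (Cmod_ge_0 (z ^ pred n)). pose proof (pos_INR n).
  assert (H3 : INR n * Cmod (z ^ pred n) <= INR (S n) ^ 2)
    by (rewrite S_INR; nra).
  rewrite Rmult_comm. apply Rmult_le_compat_r; assumption. }
replace (CPSeries (deriv_coef a) z) with (CSeries b); [exact Hb|].
symmetry. apply CSeries_unique.
apply (is_series_ext (fun k => b (S k))).
- intros n. unfold b, deriv_coef. simpl pred.
  change ((a (S n) * (INR (S n) * z ^ n))%C = (INR (S n) * a (S n) * z ^ n)%C). ring.
- apply is_series_incr_1.
  refine (eq_ind _ (fun l : C => Cis_series b l) Hb _ _).
  change (CSeries b = CSeries b + b 0%nat)%C. unfold b at 3. simpl. ring.
Qed.

(** Summing the remainders of [Cpow_taylor] with weights [a n] leaves a quadratic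
    remainder whose constant is the sum assumed finite in [summable_sq]. *)
Lemma CPSeries_is_derive (a : nat -> C) (z : C) :
  summable_sq a -> in_disk z ->
  Cis_derive (CPSeries a) z (CPSeries (deriv_coef a) z).
Proof.
intros Ha Hz. pose proof Ha as [K HK].
unfold in_disk in Hz.
assert (Hd : 0 < 1 - Cmod z) by lra.
apply Cis_derive_quadratic with (K := K) (d := mkposreal _ Hd).
intros w Hw. simpl in Hw.
assert (Hw1 : Cmod w <= 1).
{ pose proof (Cmod_triangle z (w - z)) as H1.
  replace (z + (w - z))%C with w in H1 by ring. lra. }
assert (Hz1 : Cmod z <= 1) by lra.
pose proof (CPSeries_correct a w Ha Hw1) as Sw.
pose proof (CPSeries_correct a z Ha Hz1) as Sz.
pose proof (CPSeries_derive_shift a z Ha Hz1) as Sd.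
pose proof (is_series_plus _ _ _ _ (is_series_plus _ _ _ _ Sw
  (is_series_opp _ _ Sz)) (is_series_opp _ _ (is_series_scal (w - z)%C _ _ Sd))) as St.
refine (Cis_series_bound _ (fun n => Cmod (w - z) ^ 2 * (INR (S n) ^ 2 * Cmod (a n)))
  _ _ _ St _).
- intros n.
  change (Cmod (a n * w ^ n + - (a n * z ^ n) +
     - ((w - z) * (a n * (INR n * z ^ pred n)))) <=
     Cmod (w - z) ^ 2 * (INR (S n) ^ 2 * Cmod (a n))).
  replace (a n * w ^ n + - (a n * z ^ n) + - ((w - z) * (a n * (INR n * z ^ pred n))))%C
    with (a n * (w ^ n - z ^ n - (w - z) * (INR n * z ^ pred n)))%C by ring.
  rewrite Cmod_mult.
  pose proof (Cpow_taylor n z w Hz1 Hw1) as HT.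
  pose proof (Cmod_ge_0 (a n)). pose proof (pos_INR n).
  pose proof (pow2_ge_0 (Cmod (w - z))).
  assert (INR n ^ 2 <= INR (S n) ^ 2) by (rewrite S_INR; nra).
  replace (Cmod (w - z) ^ 2 * (INR (S n) ^ 2 * Cmod (a n))) with
    (Cmod (a n) * (INR (S n) ^ 2 * Cmod (w - z) ^ 2)) by ring.
  apply Rmult_le_compat_l; [assumption|].
  eapply Rle_trans; [exact HT|]. apply Rmult_le_compat_r; assumption.
- rewrite Rmult_comm. exact (is_series_scal (Cmod (w - z) ^ 2) _ _ HK).
Qed.

Lemma INR_S_le_pow2 (n : nat) : INR (S n) <= 2 ^ n.
Proof.
rewrite <- (pow_INR 2). apply le_INR. pose proof (Nat.pow_gt_lin_r 2 n). lia.
Qed.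

(** The bound 1/4 comes from the crude estimate [(n + 1) ^ 2 <= 4 ^ n]. *)
Lemma summable_sq_geometric (a : nat -> C) (K r : R) :
  0 <= r < 1 / 4 -> (forall n, Cmod (a n) <= K * r ^ n) -> summable_sq a.
Proof.
intros Hr Ha.
apply (ex_series_le (V := R_CompleteNormedModule)) with (b := fun n => K * (4 * r) ^ n).
- intros n. change (Rabs (INR (S n) ^ 2 * Cmod (a n)) <= K * (4 * r) ^ n).
  pose proof (Cmod_ge_0 (a n)). pose proof (pos_INR (S n)).
  rewrite Rabs_pos_eq by (apply Rmult_le_pos; [apply pow2_ge_0 | assumption]).
  pose proof (INR_S_le_pow2 n) as H1.
  assert (H2 : INR (S n) ^ 2 <= 4 ^ n).
  { replace 4 with (2 ^ 2) by ring. rewrite <- pow_mult, Nat.mul_comm, pow_mult.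
    apply pow_incr. split; assumption. }
  rewrite Rpow_mult_distr.
  replace (K * (4 ^ n * r ^ n)) with (4 ^ n * (K * r ^ n)) by ring.
  apply Rmult_le_compat; [apply pow2_ge_0 | assumption | assumption | apply Ha].
- apply (ex_series_scal (K := R_AbsRing) (V := R_NormedModule) K).
  apply ex_series_geom. rewrite Rabs_pos_eq; lra.
Qed.

Lemma CPSeries_ext (a b : nat -> C) (z : C) :
  (forall n, a n = b n) -> summable_sq a -> Cmod z <= 1 ->
  CPSeries a z = CPSeries b z.
Proof.
intros H Ha Hz. symmetry. apply CSeries_unique.
apply (is_series_ext (fun n => a n * z ^ n)%C).
- intros n. now rewrite H.
- now apply CPSeries_correct.
Qed.

Lemma CPSeries_tail (a : nat -> C) (z : C) :
  summable_sq a -> Cmod z <= 1 ->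
  Cis_series (fun k => a (S k) * z ^ S k)%C (CPSeries a z - a 0%nat)%C.
Proof.
intros Ha Hz.
apply (is_series_incr_1 (K := C_AbsRing) (V := C_NormedModule)
  (fun n => a n * z ^ n)%C).
refine (eq_ind _ (fun l : C => Cis_series _ l) (CPSeries_correct a z Ha Hz) _ _).
change (CPSeries a z = CPSeries a z - a 0%nat + a 0%nat * z ^ 0)%C.
simpl. ring.
Qed.

Lemma CPSeries_0 (a : nat -> C) : summable_sq a -> CPSeries a 0 = a 0%nat.
Proof.
intros Ha.
assert (H0 : Cmod 0 <= 1) by (rewrite Cmod_0; lra).
assert (Hg : is_series (fun n : nat => 0 * (1 / 2) ^ n) (0 * / (1 - 1 / 2))).
{ apply (is_series_scal (K := R_AbsRing) (V := R_NormedModule) 0).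
  apply is_series_geom. rewrite Rabs_pos_eq; lra. }
assert (H : Cmod (CPSeries a 0 - a 0%nat) <= 0 * / (1 - 1 / 2)).
{ refine (Cis_series_bound _ _ _ _ _ (CPSeries_tail a 0 Ha H0) Hg).
  intros n. rewrite Cpow_S, Cmult_0_l, Cmult_0_r, Cmod_0. lra. }
rewrite Rmult_0_l in H.
pose proof (Cmod_ge_0 (CPSeries a 0 - a 0%nat)).
assert (E : (CPSeries a 0 - a 0%nat)%C = 0) by (apply Cmod_eq_0; lra).
replace (CPSeries a 0) with (CPSeries a 0 - a 0%nat + a 0%nat)%C by ring.
rewrite E. ring.
Qed.

(** * The principal logarithm *)

(** The Cauchy-Riemann equations, with differentiability of the real and
    imaginary parts in the sense of Frechet; it lets the derivative of [Clog]
    be computed from real partial derivatives. *)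
Lemma Cis_derive_Cauchy_Riemann (u v : R * R -> R) (z : R * R) (a b : R) :
  filterdiff (K := R_AbsRing) (U := prod_NormedModule R_AbsRing R_NormedModule R_NormedModule)
    (V := R_NormedModule) u (locally z) (fun p => fst p * a + snd p * - b) ->
  filterdiff (K := R_AbsRing) (U := prod_NormedModule R_AbsRing R_NormedModule R_NormedModule)
    (V := R_NormedModule) v (locally z) (fun p => fst p * b + snd p * a) ->
  Cis_derive (fun w : C => (u w, v w)) z (a, b).
Proof.
intros [_ Hu] [_ Hv]. apply Cis_derive_eps. intros eps.
assert (He : 0 < eps / 2) by (pose proof (cond_pos eps); lra).
specialize (Hu z (fun P HP => HP) (mkposreal _ He)).
specialize (Hv z (fun P HP => HP) (mkposreal _ He)).
pose proof (filter_and _ _ Hu Hv) as H. clear Hu Hv.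
apply (proj1 (locally_C z _)) in H.
destruct H as [d Hd]. exists d. intros w Hw.
specialize (Hd w Hw). destruct Hd as [Hu Hv].
rewrite norm_R2_Cmod in Hu, Hv. simpl pos in Hu, Hv.
change (Rabs (u w - u z - ((fst w - fst z) * a + (snd w - snd z) * - b))
  <= eps / 2 * Cmod (w - z)) in Hu.
change (Rabs (v w - v z - ((fst w - fst z) * b + (snd w - snd z) * a))
  <= eps / 2 * Cmod (w - z)) in Hv.
eapply Rle_trans; [apply Cmod_2Rmax|].
assert (Hs : sqrt 2 <= 2).
{ rewrite <- (sqrt_square 2) at 2 by lra. apply sqrt_le_1; lra. }
assert (Hm : Rmax (Rabs (fst ((u w, v w) - (u z, v z) - (w - z) * (a, b))%C))
   (Rabs (snd ((u w, v w) - (u z, v z) - (w - z) * (a, b))%C))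
   <= eps / 2 * Cmod (w - z)).
{ apply Rmax_lub;
    [eapply Rle_trans; [|exact Hu] | eapply Rle_trans; [|exact Hv]];
    right; f_equal; simpl; ring. }
pose proof (Cmod_ge_0 (w - z)). pose proof (cond_pos eps).
apply Rle_trans with (2 * (eps / 2 * Cmod (w - z))); [|right; field].
apply Rmult_le_compat; [apply sqrt_pos | | exact Hs | exact Hm].
eapply Rle_trans; [apply Rabs_pos | apply Rmax_l].
Qed.

(** The principal branch on the right half-plane; [ln |z|] is written as half the
    logarithm of [|z|^2] to keep square roots out of its derivatives. *)
Definition Clog (z : C) : C := (ln (Re z ^ 2 + Im z ^ 2) / 2, atan (Im z / Re z)).

Lemma Cexp_Clog (z : C) : 0 < Re z -> Cexp (Clog z) = z.
Proof.
destruct z as [x y]. unfold Cexp, Clog, Re, Im. cbn [fst snd]. intros Hx.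
assert (Hs : 0 < x ^ 2 + y ^ 2) by nra.
assert (Hq : 0 < 1 + (y / x)²) by (pose proof (Rle_0_sqr (y / x)); lra).
assert (E : exp (ln (x ^ 2 + y ^ 2) / 2) = x * sqrt (1 + (y / x)²)).
{ rewrite <- (sqrt_square (exp (ln (x ^ 2 + y ^ 2) / 2))) by (left; apply exp_pos).
  rewrite <- exp_plus.
  replace (ln (x ^ 2 + y ^ 2) / 2 + ln (x ^ 2 + y ^ 2) / 2)
    with (ln (x ^ 2 + y ^ 2)) by field.
  rewrite exp_ln by exact Hs.
  rewrite <- (sqrt_square x) at 2 by lra. rewrite <- sqrt_mult by nra.
  f_equal. unfold Rsqr. field. lra. }
rewrite E, cos_atan, sin_atan.
pose proof (sqrt_lt_R0 _ Hq). f_equal; field; lra.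
Qed.

Lemma Cis_derive_Clog (z : C) : 0 < Re z -> Cis_derive Clog z (/ z)%C.
Proof.
destruct z as [x y]. unfold Re. cbn [fst]. intros Hx.
assert (Hs : 0 < x ^ 2 + y ^ 2) by nra.
assert (Hpos : locally (x, y) (fun p : R * R => 0 < fst p)).
{ assert (Hball : forall t : R, Rabs (t - x) < x -> 0 < t)
    by (intros t Ht; apply Rabs_lt_between in Ht; lra).
  exists (mkposreal _ Hx). intros p [Hp _]. apply Hball. exact Hp. }
assert (Hc : forall f : R * R -> R, continuous f (x, y) ->
   continuous (fun p => f p * / (fst p * fst p + snd p * snd p)) (x, y)).
{ intros f Hf.
  apply (continuous_mult (K := R_AbsRing) f); [exact Hf|].
  apply (continuous_comp (fun p : R * R => fst p * fst p + snd p * snd p) Rinv).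
  - apply (continuous_plus (V := R_NormedModule));
      apply (continuous_mult (K := R_AbsRing));
      (apply continuous_fst || apply continuous_snd).
  - apply continuous_Rinv. simpl. nra. }
replace (/ (x, y))%C with (x / (x ^ 2 + y ^ 2), - y / (x ^ 2 + y ^ 2)) by reflexivity.
apply (Cis_derive_Cauchy_Riemann (fun p => ln (fst p ^ 2 + snd p ^ 2) / 2)
   (fun p => atan (snd p / fst p)) (x, y)).
- eapply filterdiff_ext_lin.
  + apply (is_derive_filterdiff (fun x y => ln (x ^ 2 + y ^ 2) / 2) x y
      (fun x y => x * / (x * x + y * y)) (y / (x ^ 2 + y ^ 2))).
    * revert Hpos. apply filter_imp. intros [u v]. simpl. intros Hu.
      auto_derive; [nra | field; nra].
    * auto_derive; [nra | field; nra].
    * apply (Hc fst). apply continuous_fst.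
  + intros [u v].
    change (u * (x * / (x * x + y * y)) + v * (y / (x ^ 2 + y ^ 2))
            = u * (x / (x ^ 2 + y ^ 2)) + v * - (- y / (x ^ 2 + y ^ 2))).
    field. nra.
- eapply filterdiff_ext_lin.
  + apply (is_derive_filterdiff (fun x y => atan (y / x)) x y
      (fun x y => - y * / (x * x + y * y)) (x / (x ^ 2 + y ^ 2))).
    * revert Hpos. apply filter_imp. intros [u v]. simpl. intros Hu.
      auto_derive; [lra | unfold Rsqr; field; nra].
    * auto_derive; [lra | unfold Rsqr; field; nra].
    * apply (Hc (fun p => - snd p)).
      apply (continuous_opp (V := R_NormedModule) snd), continuous_snd.
  + intros [u v].
    change (u * (- y * / (x * x + y * y)) + v * (x / (x ^ 2 + y ^ 2))
            = u * (- y / (x ^ 2 + y ^ 2)) + v * (x / (x ^ 2 + y ^ 2))).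
    field. nra.
Qed.

Lemma ln_le_pred (s : R) : 0 < s -> ln s <= s - 1.
Proof. intros Hs. pose proof (exp_ineq1_le (ln s)). rewrite exp_ln in H; lra. Qed.

Lemma Rabs_atan_le (t : R) : Rabs (atan t) <= Rabs t.
Proof.
pose proof (bounded_variation atan (fun x => / (1 + x²)) 1 0 t) as H.
rewrite atan_0, !Rminus_0_r, Rmult_1_l in H. apply H.
intros x _. split; [apply is_derive_atan|].
pose proof (Rle_0_sqr x).
rewrite Rabs_pos_eq by (left; apply Rinv_0_lt_compat; lra).
rewrite <- Rinv_1. apply Rinv_le_contravar; lra.
Qed.

(** The image of the unit disk under [exp] contains the disk of centre 1 and radius
    [1 - 1 / e]; the radius 1/4 already leaves room for elementary bounds: real and
    imaginary parts of the logarithm are at most 7/18 and 1/3. *)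
Lemma Cmod_Clog_lt_1 (z : C) : Cmod (z - 1) <= 1 / 4 -> Cmod (Clog z) < 1.
Proof.
intros H.
pose proof (Rmax_Cmod (z - 1)%C) as Hm.
assert (H1 : Rabs (fst (z - 1)%C) <= 1 / 4)
  by (eapply Rle_trans; [apply Rmax_l | eapply Rle_trans; [exact Hm | exact H]]).
assert (H2 : Rabs (snd (z - 1)%C) <= 1 / 4)
  by (eapply Rle_trans; [apply Rmax_r | eapply Rle_trans; [exact Hm | exact H]]).
destruct z as [x y]. simpl in H1, H2. clear H Hm.
apply Rabs_le_between in H1, H2.
unfold Clog, Re, Im, Cmod. cbn [fst snd].
set (s := x ^ 2 + y ^ 2).
assert (Hs : 9 / 16 <= s <= 13 / 8) by (unfold s; nra).
assert (L1 : ln s <= 5 / 8) by (pose proof (ln_le_pred s); lra).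
assert (L2 : - (7 / 9) <= ln s).
{ assert (Hi : 0 < / s) by (apply Rinv_0_lt_compat; lra).
  pose proof (ln_le_pred (/ s) Hi) as L. rewrite ln_Rinv in L by lra.
  assert (/ s <= / (9 / 16)) by (apply Rinv_le_contravar; lra). lra. }
assert (L3 : - (1 / 3) <= atan (y / x) <= 1 / 3).
{ apply Rabs_le_between. eapply Rle_trans; [apply Rabs_atan_le|].
  apply Rabs_le_between. split.
  - apply Rmult_le_reg_r with x; [lra|].
    replace (y / x * x) with y by (field; lra). lra.
  - apply Rmult_le_reg_r with x; [lra|].
    replace (y / x * x) with y by (field; lra). lra. }
rewrite <- sqrt_1. apply sqrt_lt_1_alt. split; [nra|].
nra.
Qed.

(** The Schwarz function that witnesses the subordination is [Clog] composed with [p]. *)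
Lemma class_Pe_near_1 (p : C -> C) :
  analytic_disk p -> p 0 = 1 ->
  (forall z, in_disk z -> Cmod (p z - 1) <= 1 / 4) -> class_Pe p.
Proof.
intros Hp Hp0 Hb.
assert (Hre : forall z, in_disk z -> 0 < Re (p z)).
{ intros z Hz. pose proof (re_le_Cmod (p z - 1)) as H.
  pose proof (Rle_trans _ _ _ H (Hb z Hz)) as H1.
  apply Rabs_le_between in H1. simpl in H1. unfold Re. lra. }
split; [exact Hp|]. split; [exact Hp0|].
exists (fun z => Clog (p z)). repeat split.
- intros z Hz. destruct (Hp z Hz) as [l Hl].
  exists (l * / p z)%C. apply Cis_derive_comp; [|exact Hl].
  apply Cis_derive_Clog, Hre, Hz.
- rewrite Hp0. unfold Clog. simpl.
  replace (1 * (1 * 1) + 0 * (0 * 1)) with 1 by ring.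
  rewrite ln_1. unfold Rdiv. rewrite !Rmult_0_l, atan_0. reflexivity.
- intros z Hz. apply Cmod_Clog_lt_1, Hb, Hz.
- intros z Hz. symmetry. apply Cexp_Clog, Hre, Hz.
Qed.

(** * The Alexander transform as a primitive *)

(** The integral in [alexander] has a real variable, so the complex derivative has to
    be read along the segment from 0 to [z]. *)
Lemma is_derive_segment (F : C -> C) (z l : C) (s : R) :
  Cis_derive F (s * z)%C l ->
  is_derive (K := R_AbsRing) (V := C_R_NormedModule)
    (fun t : R => F (t * z)%C) s (z * l)%C.
Proof.
intros HF. split; [apply is_linear_scal_l|].
intros x Hx. rewrite <- (is_filter_lim_locally_unique (V := R_NormedModule) s x Hx).
intros eps.
pose proof (Cmod_ge_0 z) as Hz.
assert (He : 0 < eps / (1 + Cmod z))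
  by (apply Rdiv_lt_0_compat; [apply cond_pos | lra]).
destruct (proj1 (Cis_derive_eps _ _ _) HF (mkposreal _ He)) as [d Hd].
simpl pos in Hd.
assert (Hd' : 0 < d / (1 + Cmod z))
  by (apply Rdiv_lt_0_compat; [apply cond_pos | lra]).
assert (H : forall t : R, Rabs (t - s) < d / (1 + Cmod z) ->
  Cmod (F (t * z)%C - F (s * z)%C - RtoC (t - s) * (z * l)) <= eps * Rabs (t - s)).
{ intros t Ht. pose proof (Rabs_pos (t - s)) as Hts.
  assert (Em : Cmod (t * z - s * z) = Rabs (t - s) * Cmod z).
  { rewrite <- Cmod_R, <- Cmod_mult. f_equal. rewrite RtoC_minus. ring. }
  assert (Hdz : Rabs (t - s) * (1 + Cmod z) < d).
  { replace (pos d) with (d / (1 + Cmod z) * (1 + Cmod z)) by (field; lra).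
    apply Rmult_lt_compat_r; lra. }
  replace (RtoC (t - s) * (z * l))%C with ((t * z - s * z) * l)%C
    by (rewrite RtoC_minus; ring).
  eapply Rle_trans; [apply Hd; rewrite Em; nra|].
  rewrite Em.
  apply Rle_trans with (eps / (1 + Cmod z) * (Rabs (t - s) * (1 + Cmod z))).
  - apply Rmult_le_compat_l; [lra|]. nra.
  - right. field. lra. }
exists (mkposreal _ Hd'). intros t Ht. specialize (H t Ht).
eapply Rle_trans; [|exact H]. right.
etransitivity; [apply norm_R2_Cmod|]. f_equal.
apply injective_projections; simpl.
- change (fst (F (t * z)%C) + - fst (F (s * z)%C) + - ((t + - s) * fst (z * l)%C) =
    fst (F (t * z)%C - F (s * z)%C - RtoC (t - s) * (z * l))%C).
  simpl. ring.
- change (snd (F (t * z)%C) + - snd (F (s * z)%C) + - ((t + - s) * snd (z * l)%C) =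
    snd (F (t * z)%C - F (s * z)%C - RtoC (t - s) * (z * l))%C).
  simpl. ring.
Qed.

Lemma in_disk_segment (z : C) (s : R) : in_disk z -> 0 <= s <= 1 -> in_disk (s * z).
Proof.
unfold in_disk. intros Hz Hs. rewrite Cmod_mult, Cmod_R, Rabs_pos_eq by lra.
pose proof (Cmod_ge_0 z). nra.
Qed.

(** Along the segment, the integrand is the derivative of [s |-> F (s z)] wherever
    [s <> 0]. *)
Lemma alexander_primitive (F G h : C -> C) (z : C) :
  (forall w, in_disk w -> Cis_derive F w (G w)) ->
  analytic_disk G -> F 0 = 0 ->
  (forall w, in_disk w -> h w = (w * G w)%C) ->
  in_disk z -> alexander h z = F z.
Proof.
intros HF HG HF0 Hh Hz. unfold alexander.
apply (is_RInt_unique (V := C_R_CompleteNormedModule)).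
apply (is_RInt_ext (V := C_R_NormedModule) (fun s : R => (z * G (s * z)%C)%C)).
- rewrite Rmin_left, Rmax_right by lra. intros s Hs.
  rewrite Hh by (apply in_disk_segment; [exact Hz | lra]).
  match goal with |- ?u = ?v => change (@eq C u v) end.
  destruct (Ceq_dec z 0) as [->|Hz0]; [ring|].
  field. split; [exact Hz0 | intros E; apply RtoC_inj in E; lra].
- refine (eq_ind (F (1 * z)%C - F (0 * z)%C)%C
    (fun l : C => is_RInt (V := C_R_NormedModule) _ 0 1 l) _ _ _).
  2: { rewrite Cmult_0_l, Cmult_1_l, HF0. ring. }
  apply (is_RInt_derive (V := C_R_CompleteNormedModule) (fun t : R => F (t * z)%C)).
  + rewrite Rmin_left, Rmax_right by lra. intros s Hs.
    apply is_derive_segment, HF, in_disk_segment; assumption.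
  + rewrite Rmin_left, Rmax_right by lra. intros s Hs.
    destruct (HG (s * z)%C) as [l Hl]; [apply in_disk_segment; assumption|].
    apply (ex_derive_continuous (K := R_AbsRing) (V := C_R_NormedModule)
      (fun t : R => (z * G (t * z)%C)%C)).
    eexists. apply (is_derive_segment (fun w => z * G w)%C).
    apply Cis_derive_mult; [apply Cis_derive_const | exact Hl].
Qed.

(** * Series with rapidly decaying coefficients *)

(** The ratio 1/12 is what the main inequality on [mu] and [nu] yields for the
    Lommel coefficients: each step multiplies by 1/4 and divides by at least 3. *)
Definition decay12 (c : nat -> C) : Prop :=
  c 0%nat = 1 /\ forall n, Cmod (c n) <= (1 / 12) ^ n.

Lemma decay12_summable (c : nat -> C) : decay12 c -> summable_sq c.
Proof.
intros [_ H]. apply (summable_sq_geometric c 1 (1 / 12)); [lra|].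
intros n. rewrite Rmult_1_l. apply H.
Qed.

(** The factor [n + 1] is absorbed by [2 ^ n], which turns the ratio 1/12 into 1/6. *)
Lemma decay12_derive (c : nat -> C) (n : nat) :
  decay12 c -> Cmod (deriv_coef c n) <= 1 / 12 * (1 / 6) ^ n.
Proof.
intros [_ H]. unfold deriv_coef.
rewrite Cmod_mult, Cmod_R, Rabs_pos_eq by apply pos_INR.
pose proof (INR_S_le_pow2 n) as H1.
replace (1 / 12 * (1 / 6) ^ n) with (2 ^ n * (1 / 12) ^ S n).
- apply Rmult_le_compat; [apply pos_INR | apply Cmod_ge_0 | exact H1 | apply H].
- simpl pow at 2. replace (1 / 6) with (2 * (1 / 12)) by field.
  rewrite Rpow_mult_distr. ring.
Qed.

Lemma decay12_derive_summable (c : nat -> C) :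
  decay12 c -> summable_sq (deriv_coef c).
Proof.
intros H. apply (summable_sq_geometric _ (1 / 12) (1 / 6)); [lra|].
intros n. now apply decay12_derive.
Qed.

Lemma decay12_CPSeries_near_1 (c : nat -> C) (z : C) :
  decay12 c -> in_disk z -> Cmod (CPSeries c z - 1) <= 1 / 11.
Proof.
intros Hc Hz. unfold in_disk in Hz.
assert (Hz1 : Cmod z <= 1) by lra.
pose proof (CPSeries_tail c z (decay12_summable c Hc) Hz1) as Ht.
destruct Hc as [H0 Hc]. rewrite H0 in Ht.
assert (Hg : is_series (fun n => 1 / 12 * (1 / 12) ^ n) (1 / 12 * / (1 - 1 / 12))).
{ apply (is_series_scal (K := R_AbsRing) (V := R_NormedModule) (1 / 12)).
  apply is_series_geom. rewrite Rabs_pos_eq; lra. }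
replace (1 / 11) with (1 / 12 * / (1 - 1 / 12)) by field.
refine (Cis_series_bound _ _ _ _ _ Ht Hg).
intros n. rewrite Cmod_mult.
pose proof (Cmod_pow_le_1 z (S n) Hz1). pose proof (Hc (S n)) as H1.
simpl pow in H1. pose proof (Cmod_ge_0 (c (S n))). pose proof (Cmod_ge_0 (z ^ S n)).
nra.
Qed.

Lemma decay12_CPSeries_derive_bound (c : nat -> C) (z : C) :
  decay12 c -> in_disk z -> Cmod (CPSeries (deriv_coef c) z) <= 1 / 10.
Proof.
intros Hc Hz. unfold in_disk in Hz.
assert (Hz1 : Cmod z <= 1) by lra.
pose proof (CPSeries_correct _ z (decay12_derive_summable c Hc) Hz1) as Ht.
assert (Hg : is_series (fun n => 1 / 12 * (1 / 6) ^ n) (1 / 12 * / (1 - 1 / 6))).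
{ apply (is_series_scal (K := R_AbsRing) (V := R_NormedModule) (1 / 12)).
  apply is_series_geom. rewrite Rabs_pos_eq; lra. }
replace (1 / 10) with (1 / 12 * / (1 - 1 / 6)) by field.
refine (Cis_series_bound _ _ _ _ _ Ht Hg).
intros n. rewrite Cmod_mult.
pose proof (Cmod_pow_le_1 z n Hz1). pose proof (decay12_derive c n Hc) as H1.
pose proof (Cmod_ge_0 (deriv_coef c n)). pose proof (Cmod_ge_0 (z ^ n)).
nra.
Qed.

Lemma decay12_CPSeries_lower (c : nat -> C) (z : C) :
  decay12 c -> in_disk z -> 10 / 11 <= Cmod (CPSeries c z).
Proof.
intros Hc Hz. pose proof (decay12_CPSeries_near_1 c z Hc Hz) as H.
pose proof (Cmod_triangle (CPSeries c z) (1 - CPSeries c z)) as H1.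
replace (CPSeries c z + (1 - CPSeries c z))%C with (RtoC 1) in H1 by ring.
rewrite Cmod_1, <- (Cmod_opp (1 - _)) in H1.
replace (- (1 - CPSeries c z))%C with (CPSeries c z - 1)%C in H1 by ring.
lra.
Qed.

Lemma decay12_CPSeries_neq_0 (c : nat -> C) (z : C) :
  decay12 c -> in_disk z -> CPSeries c z <> 0.
Proof.
intros Hc Hz E. pose proof (decay12_CPSeries_lower c z Hc Hz) as H.
rewrite E, Cmod_0 in H. lra.
Qed.

(** With [G] the sum of the series, this is [z h' / h] for [h = z G], and
    also [1 + z f'' / f'] for [f' = G]. *)
Definition log_ratio (c : nat -> C) (z : C) : C :=
  (1 + z * CPSeries (deriv_coef c) z / CPSeries c z)%C.

(** [log_ratio c z - 1] has modulus at most (1/10) / (10/11) = 11/100. *)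
Lemma log_ratio_class_Pe (c : nat -> C) (p : C -> C) :
  decay12 c -> (forall z, in_disk z -> p z = log_ratio c z) -> class_Pe p.
Proof.
intros Hc Hp. apply class_Pe_near_1.
- intros z Hz. eexists.
  apply (Cis_derive_ext_disk (fun z => 1 + z * CPSeries (deriv_coef c) z * / CPSeries c z)%C
    p z _ (fun w Hw => eq_sym (Hp w Hw)) Hz).
  apply (is_derive_plus (K := C_AbsRing) (V := C_NormedModule) (fun _ => RtoC 1)).
  + apply Cis_derive_const.
  + apply Cis_derive_mult.
    * apply Cis_derive_mult; [apply Cis_derive_id|].
      apply CPSeries_is_derive; [now apply decay12_derive_summable | exact Hz].
    * apply (Cis_derive_comp Cinv (CPSeries c)).
      -- apply Cis_derive_inv. now apply decay12_CPSeries_neq_0.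
      -- apply CPSeries_is_derive; [now apply decay12_summable | exact Hz].
- rewrite Hp by exact in_disk_0.
  unfold log_ratio, Cdiv. rewrite !Cmult_0_l. apply Cplus_0_r.
- intros z Hz. rewrite Hp by exact Hz. unfold log_ratio.
  replace (1 + z * CPSeries (deriv_coef c) z / CPSeries c z - 1)%C
    with (z * CPSeries (deriv_coef c) z * / CPSeries c z)%C
    by (unfold Cdiv; ring).
  pose proof (decay12_CPSeries_derive_bound c z Hc Hz) as H1.
  pose proof (decay12_CPSeries_lower c z Hc Hz) as H2.
  rewrite !Cmod_mult, Cmod_inv by now apply decay12_CPSeries_neq_0.
  apply Rmult_le_reg_r with (Cmod (CPSeries c z)); [lra|].
  rewrite Rmult_assoc, Rinv_l, Rmult_1_r by lra.
  unfold in_disk in Hz. pose proof (Cmod_ge_0 z).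
  pose proof (Cmod_ge_0 (CPSeries (deriv_coef c) z)). nra.
Qed.

Lemma exp_starlike_decay12 (c : nat -> C) (h : C -> C) :
  decay12 c -> (forall z, in_disk z -> h z = (z * CPSeries c z)%C) ->
  exp_starlike h.
Proof.
intros Hc Hh.
assert (Hd : forall z, in_disk z ->
  Cis_derive h z (CPSeries c z + z * CPSeries (deriv_coef c) z)%C).
{ intros z Hz.
  apply (Cis_derive_ext_disk (fun z => z * CPSeries c z)%C
    h z _ (fun w Hw => eq_sym (Hh w Hw)) Hz).
  refine (eq_ind _ (fun l : C => Cis_derive _ z l) (Cis_derive_mult _ _ z _ _
    (Cis_derive_id z) (CPSeries_is_derive c z (decay12_summable c Hc) Hz)) _ _).
  simpl. ring. }
split; [|split].
- split; [intros z Hz; eexists; exact (Hd z Hz)|]. split.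
  + rewrite (Hh 0 in_disk_0). apply Cmult_0_l.
  + rewrite (C_derive_unique _ _ _ (Hd _ in_disk_0)), Cmult_0_l, Cplus_0_r,
      CPSeries_0 by now apply decay12_summable.
    apply Hc.
- intros z Hz Hz0. rewrite Hh by exact Hz.
  apply Cmult_neq_0; [exact Hz0 | now apply decay12_CPSeries_neq_0].
- apply (log_ratio_class_Pe c); [exact Hc|]. intros z Hz. unfold log_ratio.
  destruct (Ceq_dec z 0) as [->|Hz0].
  + unfold Cdiv. rewrite !Cmult_0_l. symmetry. apply Cplus_0_r.
  + rewrite (C_derive_unique _ _ _ (Hd _ Hz)), Hh by exact Hz.
    field. split; [now apply decay12_CPSeries_neq_0 | exact Hz0].
Qed.

Lemma exp_convex_decay12 (c : nat -> C) (f : C -> C) :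
  decay12 c -> f 0 = 0 ->
  (forall z, in_disk z -> Cis_derive f z (CPSeries c z)) ->
  exp_convex f.
Proof.
intros Hc Hf0 Hd.
assert (Hd2 : forall z, in_disk z ->
  Cis_derive (C_derive f) z (CPSeries (deriv_coef c) z)).
{ intros z Hz.
  apply (Cis_derive_ext_disk (CPSeries c) _ z).
  - intros w Hw. symmetry. apply C_derive_unique, Hd, Hw.
  - exact Hz.
  - apply CPSeries_is_derive; [now apply decay12_summable | exact Hz]. }
split; [|split].
- split; [intros z Hz; eexists; exact (Hd z Hz)|]. split; [exact Hf0|].
  rewrite (C_derive_unique _ _ _ (Hd _ in_disk_0)), CPSeries_0
    by now apply decay12_summable.
  apply Hc.
- intros z Hz. rewrite (C_derive_unique _ _ _ (Hd _ Hz)).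
  now apply decay12_CPSeries_neq_0.
- apply (log_ratio_class_Pe c); [exact Hc|]. intros z Hz. unfold log_ratio.
  now rewrite (C_derive_unique _ _ _ (Hd _ Hz)), (C_derive_unique _ _ _ (Hd2 _ Hz)).
Qed.

Definition prim_coef (a : nat -> C) (n : nat) : C :=
  match n with O => RtoC 0 | S k => (/ INR (S k) * a k)%C end.

(** The derivative of the Alexander transform is [h z / z], that is, the series
    itself. *)
Lemma alexander_decay12_derive (c : nat -> C) (h : C -> C) :
  decay12 c -> (forall z, in_disk z -> h z = (z * CPSeries c z)%C) ->
  alexander h 0 = 0 /\
  forall z, in_disk z -> Cis_derive (alexander h) z (CPSeries c z).
Proof.
intros Hc Hh.
pose proof (decay12_summable c Hc) as Sc.
assert (Si : summable_sq (prim_coef c)).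
{ (* the constant 12 makes up for the shift of the index by one *)
  apply (summable_sq_geometric _ 12 (1 / 12)); [lra|].
  intros [|n]; [simpl; rewrite Cmod_0; lra|].
  unfold prim_coef. pose proof (proj2 Hc n) as Hn.
  assert (H1 : 1 <= INR (S n)) by (rewrite S_INR; pose proof (pos_INR n); lra).
  rewrite Cmod_mult, <- RtoC_inv, Cmod_R, Rabs_pos_eq
    by (try (left; apply Rinv_0_lt_compat); lra).
  assert (/ INR (S n) <= 1) by (rewrite <- Rinv_1; apply Rinv_le_contravar; lra).
  assert (0 < / INR (S n)) by (apply Rinv_0_lt_compat; lra).
  pose proof (Cmod_ge_0 (c n)).
  replace (12 * (1 / 12) ^ S n) with ((1 / 12) ^ n) by (simpl; field).
  nra. }
assert (HF : forall w, in_disk w -> Cis_derive (CPSeries (prim_coef c)) w (CPSeries c w)).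
{ intros w Hw.
  replace (CPSeries c w) with (CPSeries (deriv_coef (prim_coef c)) w);
    [now apply CPSeries_is_derive|].
  symmetry. apply CPSeries_ext; [|exact Sc | unfold in_disk in Hw; lra].
  intros n. unfold deriv_coef, prim_coef. field.
  intros E. apply RtoC_inj in E. revert E. apply not_0_INR. lia. }
assert (HA : forall z, in_disk z -> alexander h z = CPSeries (prim_coef c) z).
{ intros z Hz. apply (alexander_primitive _ (CPSeries c)); try assumption.
  - intros w Hw. eexists. now apply CPSeries_is_derive.
  - now apply CPSeries_0. }
split.
- rewrite (HA 0 in_disk_0). now apply CPSeries_0.
- intros z Hz. apply (Cis_derive_ext_disk (CPSeries (prim_coef c)));
    [|exact Hz | now apply HF].
  intros w Hw. symmetry. now apply HA.
Qed.

(** * The Lommel series *)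

(** Each factor [(a + k) (b + k)] of the product is at least [a b]. *)
Lemma pochhammer_mult_lower (a b m : R) (n : nat) :
  0 < a -> 0 < b -> 0 <= m <= a * b ->
  m ^ n <= pochhammer a n * pochhammer b n.
Proof.
intros Ha Hb Hm. induction n as [|n IH]; simpl; [lra|].
pose proof (pos_INR n).
replace (pochhammer a n * (a + INR n) * (pochhammer b n * (b + INR n)))
  with ((a + INR n) * (b + INR n) * (pochhammer a n * pochhammer b n)) by ring.
apply Rmult_le_compat; [lra | apply pow_le; lra | nra | exact IH].
Qed.

(** [(mu + 3)^2 - nu^2] is four times the product of the two Pochhammer parameters,
    and [mu + 3] is their sum, so both parameters are positive. *)
Lemma lommel_coef_bound (mu nu : R) (n : nat) :
  0 < mu + 3 -> 12 <= (mu + 3) ^ 2 - nu ^ 2 ->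
  Rabs (lommel_coef mu nu n) <= (1 / 12) ^ n.
Proof.
intros Hmu Hab. unfold lommel_coef.
set (a := (mu - nu + 3) / 2). set (b := (mu + nu + 3) / 2).
assert (Hs : 0 < a + b) by (unfold a, b; lra).
assert (Hp : 3 <= a * b) by (unfold a, b; nra).
assert (Ha : 0 < a) by nra.
assert (Hb : 0 < b) by nra.
assert (Hl : 3 ^ n <= pochhammer a n * pochhammer b n)
  by (apply pochhammer_mult_lower; lra).
assert (H3 : 0 < 3 ^ n) by (apply pow_lt; lra).
unfold Rdiv at 1. rewrite Rabs_mult, <- RPow_abs, Rabs_Ropp.
rewrite (Rabs_pos_eq (1 / 4)) by lra.
rewrite Rabs_pos_eq by (left; apply Rinv_0_lt_compat; lra).
replace (1 / 12) with (1 / 4 * / 3) by field.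
rewrite Rpow_mult_distr, pow_inv.
apply Rmult_le_compat_l; [apply pow_le; lra|].
apply Rinv_le_contravar; assumption.
Qed.

(** As [e >= 2], [2 e - 1] is at most six times [e (e - 1) / 4],
    and the right-hand side is at least [2 (2 e - 1)]; hence
    [mu >= 2] and [|(mu - 1)^2 - nu^2| <= 6 mu]. The conclusion follows from
    [(mu + 3)^2 - nu^2 = (mu - 1)^2 - nu^2 + 8 mu + 8 >= 2 mu + 8]. *)
Lemma main_condition_bounds (mu nu : R) :
  mu * (2 * exp 1 - 1)
    - 1 / 4 * exp 1 * (exp 1 - 1) * Rabs ((mu - 1) ^ 2 - nu ^ 2)
  >= exp 1 ^ 3 - exp 1 ^ 2 + 13 * exp 1 / 4 - 4 ->
  2 <= mu /\ 12 <= (mu + 3) ^ 2 - nu ^ 2.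
Proof.
intros H. pose proof (exp_ineq1_le 1) as He.
set (E := exp 1) in *. set (D := Rabs _) in *.
assert (HD : 0 <= D) by apply Rabs_pos.
assert (HE : 2 <= E) by lra.
assert (HK : 2 * (2 * E - 1) <= E ^ 3 - E ^ 2 + 13 * E / 4 - 4) by nra.
set (X := 1 / 4 * E * (E - 1)) in *.
assert (HX : 2 * E - 1 <= 6 * X) by (unfold X; nra).
assert (Hmu : 2 <= mu).
{ apply Rmult_le_reg_r with (2 * E - 1); [lra|].
  assert (0 <= X * D) by (apply Rmult_le_pos; lra). lra. }
split; [exact Hmu|].
assert (HDmu : D <= 6 * mu).
{ apply Rmult_le_reg_l with X; [lra|].
  apply Rle_trans with (mu * (2 * E - 1)); [lra|]. nra. }
pose proof (Rle_abs (- ((mu - 1) ^ 2 - nu ^ 2))) as HA.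
rewrite Rabs_Ropp in HA. fold D in HA. nra.
Qed.

Lemma lommel_h_factor (mu nu : R) (z : C) :
  decay12 (fun n => RtoC (lommel_coef mu nu n)) -> in_disk z ->
  lommel_h mu nu z = (z * CPSeries (fun n => RtoC (lommel_coef mu nu n)) z)%C.
Proof.
intros Hc Hz. unfold in_disk in Hz.
assert (Hz1 : Cmod z <= 1) by lra.
set (c := fun n => RtoC (lommel_coef mu nu n)) in *.
unfold lommel_h.
rewrite (CSeries_unique _ (z * (CPSeries c z - 1))%C); [ring|].
apply (is_series_ext (fun n => z * (c (S n) * z ^ S n))%C).
- intros n. change (z * (c (S n) * z ^ S n) = c (S n) * z ^ (S n + 1))%C.
  rewrite Cpow_add_r, Cpow_1_r. ring.
- pose proof (CPSeries_tail c z (decay12_summable c Hc) Hz1) as Ht.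
  rewrite (proj1 Hc) in Ht.
  exact (is_series_scal (K := C_AbsRing) (V := C_NormedModule) z _ _ Ht).
Qed.

Theorem theorem3p2 (mu nu : R)
  (Hplus : ~ negative_odd_integer (mu + nu))
  (Hminus : ~ negative_odd_integer (mu - nu))
  (Hcond : (mu + 1) * ((mu + 1) * (mu + 3) - nu ^ 2) >= 1 / 8)
  (Hmain : mu * (2 * exp 1 - 1)
             - 1 / 4 * exp 1 * (exp 1 - 1) * Rabs ((mu - 1) ^ 2 - nu ^ 2)
           >= exp 1 ^ 3 - exp 1 ^ 2 + 13 * exp 1 / 4 - 4) :
  exp_convex (lommel_f mu nu) /\ exp_starlike (lommel_h mu nu).
Proof.
destruct (main_condition_bounds mu nu Hmain) as [Hmu Hab].
set (c := fun n => RtoC (lommel_coef mu nu n)).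
assert (Hc : decay12 c).
{ split.
  - unfold c, lommel_coef. simpl. f_equal. field.
  - intros n. unfold c. rewrite Cmod_R. apply lommel_coef_bound; lra. }
assert (Hh : forall z, in_disk z -> lommel_h mu nu z = (z * CPSeries c z)%C).
{ intros z Hz. now apply lommel_h_factor. }
split.
- destruct (alexander_decay12_derive c (lommel_h mu nu) Hc Hh) as [H0 Hd].
  now apply (exp_convex_decay12 c).
- now apply (exp_starlike_decay12 c).
Qed.
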